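(* If a full-information learning algorithm $\mathcal A$ is monotone, then the bandit algorithm MonoBandit$(\mathcal A)$ is monotone.
   Context: Online learning with $k$ actions: in each round a loss vector in $\mathbb R^k$ is chosen and the algorithm selects an action; in the full-information setting it then observes the whole loss vector, in the bandit setting only the loss of the selected action. An algorithm (in either setting) is monotone if, for any two sequences of loss vectors that are identical except that in one round $\bar t$ the loss of one action $a$ is lower in the second, the probability (over the algorithm's randomness) of selecting $a$ in any round $t>\bar t$ is at least as large under the second sequence as under the first. MonoBandit$(\mathcal A)$ with parameter $\epsilon\in(0,1]$: in each round, with probability $1-\epsilon$ (exploit) play an action drawn from the current distribution output by $\mathcal A$ and feed $\mathcal A$ the zero vector; with probability $\epsilon/k$ for each action $j$ (explore) play $j$, observe its loss $b$, and feed $\mathcal A$ the vector with $j$-th entry $kb/\epsilon$ and all others $0$. The explore/exploit randomness is independent across rounds and of the randomness of $\mathcal A$. *)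

(* Defs.v *)
From HB Require Import structures.
From mathcomp Require Import all_boot all_order all_algebra.
From mathcomp Require Import all_classical all_reals all_analysis.
Set Implicit Arguments.
Unset Strict Implicit.
Unset Printing Implicit Defensive.
Import Order.TTheory GRing.Theory Num.Theory.
Import numFieldNormedType.Exports.
Local Open Scope classical_set_scope.
Local Open Scope ring_scope.

(* MathComp / MathComp-Analysis.  Actions are 'I_k, rounds are numbered from 0,
   and a sequence of loss vectors is a function nat -> 'rV[R]_k. *)

Definition is_distr (R : realType) (T : finType) (p : T -> R) : Prop :=
  (forall x, 0 <= p x) /\ \sum_x p x = 1.

(* In every round the algorithm outputs a distribution over the actions, which
   may depend on the loss vectors fed to it so far and on an internal random
   seed; it then selects an action drawn from that distribution.  The seed
   space is an arbitrary probability space, so that algorithms whose successive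
   choices are correlated are covered: put all the randomness in the seed and
   output Dirac distributions. *)
Record full_info_alg (R : realType) (k : nat) := FullInfoAlg {
  fi_disp : measure_display;
  fi_seed : measurableType fi_disp;
  fi_law : probability fi_seed R;
  fi_dist : seq 'rV[R]_k -> fi_seed -> 'I_k -> R;
  fi_distP : forall h w, is_distr (fi_dist h w);
  fi_measurable : forall h a, measurable_fun setT (fun w => fi_dist h w a) }.

(* A bandit algorithm draws in every round a move; the move determines the
   selected action, and may carry further private information (such as the
   outcome of an internal coin toss).  The distribution of the move depends on
   the seed, on the previous moves and on the losses of the previously selected
   actions, but on nothing else. *)
Record bandit_alg (R : realType) (k : nat) := BanditAlg {
  b_disp : measure_display;
  b_seed : measurableType b_disp;
  b_law : probability b_seed R;
  b_move : finType;
  b_act : b_move -> 'I_k;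
  b_draw : seq (b_move * R) -> b_seed -> b_move -> R;
  b_drawP : forall h w, is_distr (b_draw h w);
  b_measurable : forall h m, measurable_fun setT (fun w => b_draw h w m) }.

Definition full_info_prob (R : realType) (k : nat) (A : full_info_alg R k)
    (l : nat -> 'rV[R]_k) (t : nat) (a : 'I_k) : \bar R :=
  'E_(fi_law A)[fun w => fi_dist (mkseq l t) w a].

Definition transcript (R : realType) (k : nat) (B : bandit_alg R k)
    (l : nat -> 'rV[R]_k) (n : nat) (r : n.-tuple (b_move B)) (s : 'I_n) :
    seq (b_move B * R) :=
  take s [seq (tnth r u, l u ord0 (b_act (tnth r u))) | u <- enum 'I_n].

(* Conditional probability, given the seed w, that the moves of the first n
   rounds are r. *)
Definition moves_prob (R : realType) (k : nat) (B : bandit_alg R k)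
    (l : nat -> 'rV[R]_k) (w : b_seed B) (n : nat) (r : n.-tuple (b_move B)) :
    R :=
  \prod_(s < n) b_draw (transcript l r s) w (tnth r s).

Definition bandit_prob (R : realType) (k : nat) (B : bandit_alg R k)
    (l : nat -> 'rV[R]_k) (t : nat) (a : 'I_k) : \bar R :=
  'E_(b_law B)[fun w => \sum_(r : t.+1.-tuple (b_move B)
                               | b_act (tnth r ord_max) == a) moves_prob l w r].

(* Monotonicity, for either setting, of an algorithm that selects action a in
   round t with probability prob l t a when the loss vectors are l. *)
Definition monotone_alg (R : realType) (k : nat)
    (prob : (nat -> 'rV[R]_k) -> nat -> 'I_k -> \bar R) : Prop :=
  forall (l l' : nat -> 'rV[R]_k) (tbar : nat) (a : 'I_k),
    l' tbar ord0 a < l tbar ord0 a ->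
    (forall s b, (s, b) != (tbar, a) -> l' s ord0 b = l s ord0 b) ->
    forall t, (tbar < t)%N -> (prob l t a <= prob l' t a)%E.

Section MonoBandit.
Variables (R : realType) (k : nat) (eps : R) (A : full_info_alg R k).

(* A move is a pair (explore, j): was the round an exploration round, and which
   action j was played. *)
Definition mb_feed (o : (bool * 'I_k) * R) : 'rV[R]_k :=
  let: ((explore, j), b) := o in
  if explore then \row_i (if i == j then k%:R * b / eps else 0) else 0.

Definition mb_draw (h : seq ((bool * 'I_k) * R)) (w : fi_seed A)
    (m : bool * 'I_k) : R :=
  let: (explore, j) := m in
  if explore then eps / k%:R
  else (1 - eps) * fi_dist [seq mb_feed o | o <- h] w j.

Lemma mb_drawP (heps : 0 < eps <= 1) h w : is_distr (mb_draw h w).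
Proof.
move: heps => /andP[e0 e1].
have [p0 p1] := fi_distP [seq mb_feed o | o <- h] w.
split=> [[[] j]|] /=.
- by rewrite divr_ge0 // ltW.
- by rewrite mulr_ge0 // subr_ge0.
have k0 : k%:R != 0 :> R.
  rewrite pnatr_eq0; apply/eqP => k0.
  suff : \sum_x fi_dist [seq mb_feed o | o <- h] w x = 0.
    by rewrite p1 => /eqP; rewrite oner_eq0.
  by apply: big1 => i _; have := ltn_ord i; rewrite [X in (_ < X)%N]k0.
have -> : \sum_x mb_draw h w x = \sum_(e : bool) \sum_j mb_draw h w (e, j).
  by rewrite pair_big; apply: eq_bigr => -[].
rewrite big_bool /= sumr_const card_ord -mulr_sumr p1 mulr1 -[_ *+ k]mulr_natr.
by rewrite divfK // addrC subrK.
Qed.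

Lemma mb_measurable h m : measurable_fun setT (fun w => mb_draw h w m).
Proof.
case: m => -[] j /=; first exact: measurable_cst.
apply: measurable_realfun.measurable_funM; first exact: measurable_cst.
exact: fi_measurable.
Qed.

Definition mono_bandit (heps : 0 < eps <= 1) : bandit_alg R k :=
  BanditAlg (fi_law A) (@snd bool 'I_k) (mb_drawP heps) mb_measurable.

End MonoBandit.

(* Main.v *)
Require Import Defs.
From mathcomp Require Import all_boot all_order all_algebra.
From mathcomp Require Import all_classical all_reals all_analysis measurable_realfun.
Import Order.TTheory GRing.Theory Num.Theory.
Local Open Scope ring_scope.

(* Forget the action played in the exploitation rounds: a pattern c records, for
   each round before t, the explored action or None. Summing out the exploited
   actions, each pattern has a probability that does not depend on the losses,
   and it determines the vectors fed to A. Given c, action a is selected in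
   round t with probability eps/k + (1 - eps) P(A selects a on the fed vectors).
   Lowering the loss of a in round tbar leaves the fed vectors unchanged if a was
   not explored in that round, and otherwise lowers just the entry (tbar, a), so
   that the monotonicity of A applies pattern by pattern. *)

(** Generalised distributivity over finite functions, carried to tuples along the bijection
    [tuple_of_finfun]. *)
Lemma sum_tuple_prod (S : comPzSemiRingType) (T : finType) (n : nat)
    (Q : 'I_n -> pred T) (F : 'I_n -> T -> S) :
  \sum_(r : n.-tuple T | [forall s, Q s (tnth r s)]) \prod_s F s (tnth r s) =
  \prod_s \sum_(m | Q s m) F s m.
Proof.
rewrite bigA_distr_big_dep /=.
rewrite (reindex (@tuple_of_finfun T n)) /=; last first.
  apply: onW_bij; exists (@finfun_of_tuple T n).
    exact: tuple_of_finfunK.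
  exact: finfun_of_tupleK.
have tnthE f s : tnth (@tuple_of_finfun T n f) s = f s by rewrite tnth_mktuple.
apply: eq_big => [f|f _]; last by apply: eq_bigr => s _; rewrite tnthE.
by apply/forallP/familyP => H s; have := H s; rewrite tnthE.
Qed.

(** Nonnegativity gives additivity of the integral in the extended reals with no integrability to
    check. *)
Lemma expectation_sum_affine {d : measure_display} {T : measurableType d}
    {R : realType} (P : probability T R) (I : finType) (u v : I -> R)
    (p : I -> T -> R) :
  (forall i, 0 <= u i) -> (forall i, 0 <= v i) -> (forall i w, 0 <= p i w) ->
  (forall i, measurable_fun setT (p i)) ->
  ('E_P[fun w => (\sum_i (u i + v i * p i w))%R] =
   \sum_i ((u i)%:E + (v i)%:E * 'E_P[p i]))%E.
Proof.
move=> u0 v0 p0 mp; rewrite unlock.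
have mpE i : measurable_fun setT (fun w => (p i w)%:E).
  by apply/measurable_EFinP.
under eq_integral do rewrite -sumEFin.
rewrite ge0_integral_sum //=; last 2 first.
- move=> i; apply/measurable_EFinP; apply: measurable_funD => //.
  exact: measurable_funM.
- by move=> i w _; rewrite lee_fin addr_ge0 // mulr_ge0.
apply: eq_bigr => i _.
under eq_integral do rewrite EFinD EFinM.
rewrite ge0_integralD //=; last 3 first.
- by move=> w _; rewrite lee_fin.
- by move=> w _; rewrite -EFinM lee_fin mulr_ge0.
- exact: measurable_funeM.
rewrite integral_cst // [X in (_ * X + _)%E]probability_setT mule1
  ge0_integralZl ?lee_fin //= => w _.
by rewrite lee_fin.
Qed.

Section Patterns.
Variables (R : realType) (k : nat) (eps : R) (A : full_info_alg R k).

Definition explored (m : bool * 'I_k) : option 'I_k :=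
  if m.1 then Some m.2 else None.

Definition pattern_weight (x : option 'I_k) : R :=
  if x is Some _ then eps / k%:R else 1 - eps.

(** The default [None] feeds zero after the end of [c], which yields an infinite loss sequence to
    which monotonicity of [A] can be applied. *)
Definition fed_vector (l : nat -> 'rV[R]_k) (c : seq (option 'I_k)) (s : nat) :
    'rV[R]_k :=
  if nth None c s is Some j
  then \row_i (if i == j then k%:R * l s ord0 j / eps else 0) else 0.

Definition draw_given_fed (v : seq 'rV[R]_k) (w : fi_seed A)
    (m : bool * 'I_k) : R :=
  if m.1 then eps / k%:R else (1 - eps) * fi_dist v w m.2.

Lemma mb_drawE h w m :
  mb_draw eps h w m = draw_given_fed [seq mb_feed eps o | o <- h] w m.
Proof. by case: m. Qed.

(** The exploited actions have total mass [1 - eps] whatever [v] is, so the weights of patterns do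
    not depend on the losses. *)
Lemma sum_draw_explored v w x :
  \sum_(m | explored m == x) draw_given_fed v w m = pattern_weight x.
Proof.
case: x => [j|] /=.
  by rewrite (big_pred1 (true, j)) // => -[[] i].
have [_ p1] := fi_distP v w.
rewrite (reindex_onto (fun j : 'I_k => (false, j)) snd) /=; last by case=> -[].
under eq_bigl do rewrite eqxx.
by rewrite -mulr_sumr p1 mulr1.
Qed.

Lemma sum_draw_action v w a :
  \sum_(m : bool * 'I_k | m.2 == a) draw_given_fed v w m =
  eps / k%:R + (1 - eps) * fi_dist v w a.
Proof.
rewrite (bigD1 (true, a)) //= (big_pred1 (false, a)) // => -[[] j] /=.
  by rewrite !xpair_eqE /= andbN.
by rewrite !xpair_eqE /= andbT.
Qed.

Hypothesis heps : 0 < eps <= 1.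
Let B := mono_bandit A heps.

(** Round [t] is left out: its move selects the action in question and is fed back only later. *)
Definition pattern (t : nat) (r : t.+1.-tuple (bool * 'I_k)) :
    t.-tuple (option 'I_k) :=
  [tuple explored (tnth r (widen_ord (leqnSn t) s)) | s < t].

(** An exploitation round feeds zero whichever action was played, so the fed vectors depend on [r]
    only through its pattern. *)
Lemma map_mb_feed_transcript l t (r : t.+1.-tuple (b_move B)) (s : 'I_t.+1) :
  [seq mb_feed eps o | o <- transcript l r s] =
  mkseq (fed_vector l (pattern t r)) s.
Proof.
have sz : size (transcript l r s) = s.
  by rewrite size_take size_map size_enum_ord ltn_ord.
apply: (@eq_from_nth _ 0) => [|i]; first by rewrite size_map sz size_mkseq.
rewrite size_map sz => ltis; rewrite nth_mkseq //.
have ltit : (i < t)%N by rewrite (leq_trans ltis) // -ltnS ltn_ord.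
have ltit1 : (i < t.+1)%N by rewrite ltnW.
(* [nth_map] needs a default move, hence some action; the one played in round [s] will do. *)
have j0 : 'I_k := (tnth r s).2.
rewrite (nth_map ((true, j0), 0)) ?sz // nth_take //.
rewrite (nth_map s) ?size_enum_ord // /fed_vector.
have -> : nth s (enum 'I_t.+1) i = Ordinal ltit1.
  by apply: val_inj; rewrite /= nth_enum_ord.
rewrite -[i in nth None _ i]/(val (Ordinal ltit)) -tnth_nth tnth_mktuple.
have -> : widen_ord (leqnSn t) (Ordinal ltit) = Ordinal ltit1 by apply: val_inj.
by rewrite /explored; case: (tnth r _) => -[].
Qed.

Lemma sum_moves_prob l w t a :
  \sum_(r : t.+1.-tuple (b_move B) | b_act (tnth r ord_max) == a)
     moves_prob l w r =
  \sum_(c : t.-tuple (option 'I_k))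
     (\prod_s pattern_weight (tnth c s)) *
     (eps / k%:R + (1 - eps) * fi_dist (mkseq (fed_vector l c) t) w a).
Proof.
rewrite (partition_big (pattern t) predT) //=; apply: eq_bigr => c _.
(* [Q] splits the event (pattern [c], then action [a] in round [t]) into one condition per round.
   With [c] fixed, the factor [F s] depends on the move of round [s] alone, so the sum over moves
   factorises. *)
pose Q (s : 'I_t.+1) (m : bool * 'I_k) :=
  if (s < t)%N then explored m == nth None c s else m.2 == a.
pose F (s : 'I_t.+1) := draw_given_fed (mkseq (fed_vector l c) s) w.
have QW s m : Q (widen_ord (leqnSn t) s) m = (explored m == tnth c s).
  by rewrite /Q /= ltn_ord -tnth_nth.
have QM m : Q ord_max m = (m.2 == a) by rewrite /Q /= ltnn.
have patternP (r : t.+1.-tuple (bool * 'I_k)) :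
    ((tnth r ord_max).2 == a) && (pattern t r == c) =
    [forall s, Q s (tnth r s)].
  apply/andP/forallP => [[ra /eqP rc] s|Qr].
    have [lt_st|le_ts] := ltnP s t.
      have -> : s = widen_ord (leqnSn t) (Ordinal lt_st) by apply: val_inj.
      by rewrite QW -rc tnth_mktuple.
    have -> : s = ord_max.
      by apply: val_inj; apply/eqP; rewrite eqn_leq le_ts -ltnS ltn_ord.
    by rewrite QM.
  split; first by rewrite -QM.
  apply/eqP/eq_from_tnth => s; rewrite tnth_mktuple.
  by apply/eqP; rewrite -QW.
transitivity (\sum_(r : t.+1.-tuple (bool * 'I_k) |
    [forall s, Q s (tnth r s)]) \prod_s F s (tnth r s)).
  apply: eq_big => [r|r /andP[_ /eqP rc]]; first exact: patternP.
  rewrite /moves_prob /F -rc; apply: eq_bigr => s _.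
  by rewrite -map_mb_feed_transcript -mb_drawE.
rewrite sum_tuple_prod big_ord_recr /=; congr (_ * _).
  apply: eq_bigr => s _; rewrite (eq_bigl _ _ (QW s)).
  exact: sum_draw_explored.
by rewrite (eq_bigl _ _ QM) sum_draw_action.
Qed.

(** The losses enter the right-hand side only through [full_info_prob]. *)
Lemma bandit_prob_mono_bandit l t a :
  (bandit_prob B l t a =
   \sum_(c : t.-tuple (option 'I_k))
      (((\prod_s pattern_weight (tnth c s)) * (eps / k%:R))%:E +
       ((\prod_s pattern_weight (tnth c s)) * (1 - eps))%:E *
         full_info_prob A (fed_vector l c) t a))%E.
Proof.
have /andP[/ltW eps_ge0 eps_le1] := heps.
have epsk_ge0 : 0 <= eps / k%:R by rewrite divr_ge0.
have epsC_ge0 : 0 <= 1 - eps by rewrite subr_ge0.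
have W_ge0 (c : t.-tuple (option 'I_k)) :
    0 <= \prod_s pattern_weight (tnth c s).
  by apply: prodr_ge0 => s _; case: (tnth c s).
rewrite -expectation_sum_affine => [|c|c|c w|c].
- congr expectation; apply/funext => w; rewrite sum_moves_prob.
  by apply: eq_bigr => c _; rewrite mulrDr -mulrA.
- exact: mulr_ge0.
- exact: mulr_ge0.
- by have [] := fi_distP (mkseq (fed_vector l c) t) w.
- exact: fi_measurable.
Qed.

End Patterns.

Theorem lemma18 (R : realType) (k : nat) (eps : R) (heps : 0 < eps <= 1)
    (A : full_info_alg R k) :
  monotone_alg (full_info_prob A) ->
  monotone_alg (bandit_prob (mono_bandit A heps)).
Proof.
move=> monoA l l' tbar a ltl eql t lt_t.
have /andP[eps_gt0 eps_le1] := heps.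
have k_gt0 : (0 < k)%N by apply: leq_ltn_trans (ltn_ord a).
rewrite !bandit_prob_mono_bandit; apply: lee_sum => c _.
apply: leeD2l; apply: lee_wpmul2l.
  rewrite lee_fin mulr_ge0 ?subr_ge0 //; apply: prodr_ge0 => s _.
  by case: (tnth c s) => [j|] /=; rewrite ?subr_ge0 // divr_ge0 // ltW.
have [ca|ca] := eqVneq (nth None c tbar) (Some a).
  apply: monoA lt_t.
    (* The scaling by [k / eps] is positive, so the strict decrease survives. *)
    by rewrite /fed_vector ca !mxE eqxx ltr_pM2r ?invr_gt0 // ltr_pM2l // ltr0n.
  move=> s b sb; rewrite /fed_vector; case cs: (nth None c s) => [j|] //.
  by rewrite !mxE; case: eqP => // bj; rewrite -bj eql.
(* The fed vectors read the loss at [(s, j)] only if [j] was explored in round [s]; here [(tbar, a)]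
   is never read. *)
have -> // : fed_vector R k eps l' c = fed_vector R k eps l c.
apply/funext => s; rewrite /fed_vector; case cs: (nth None c s) => [j|] //.
apply/rowP => i; rewrite !mxE; case: eqP => // _.
by rewrite eql //; apply: contra ca => /eqP[<- <-]; apply/eqP.
Qed.
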